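(* Let $\mathcal{H}$ be a real Hilbert space, let $V\subseteq\mathcal{H}$ be a closed vector subspace, and let $T:\mathcal{H}\rightrightarrows\mathcal{H}$ be a maximal monotone operator for which there exist $\eta>0$ and $L>0$ such that $$\langle z-z',v-v'\rangle\ge \eta\|z-z'\|^2\quad\text{and}\quad \|v-v'\|\le L\|z-z'\|\qquad \forall\, v\in T(z),\ v'\in T(z').$$ Let $x_0\in V$, $y_0\in V^\perp$ and $\gamma>0$, let $\{x_k\}$, $\{y_k\}$ (together with $\{\tilde x_k\}$, $\{u_k\}$) be generated by the SPDG algorithm (described in the context) from this data, and define $$z_k=x_k+\gamma y_k\qquad\forall k\ge0.$$ Then, for all $k\ge1$, $$z_{k-1}-z_k=P_V(\gamma u_k)+P_{V^\perp}(\tilde x_k),$$ $$z_k=\big((\gamma T)_V+I\big)^{-1}z_{k-1},$$ where $(\gamma T)_V$ is the partial inverse of $\gamma T$ with respect to $V$. Consequently, the SPDG algorithm is a special instance of the proximal point method $z_k=(\lambda A+I)^{-1}z_{k-1}$ for solving $0\in A(z)$, with $\lambda=1$ and $A=(\gamma T)_V$.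
   Context: A set-valued map $T:\mathcal{H}\rightrightarrows\mathcal{H}$ is monotone if $\langle z-z',v-v'\rangle\ge0$ for all $v\in T(z)$, $v'\in T(z')$; it is maximal monotone if moreover its graph $G(T)=\{(z,v)\in\mathcal{H}\times\mathcal{H} : v\in T(z)\}$ is not properly contained in the graph of any other monotone operator on $\mathcal{H}$. For $\gamma>0$, $(\gamma T)(z)=\{\gamma v : v\in T(z)\}$. For a maximal monotone operator $S$, the resolvent $(S+I)^{-1}$ is an everywhere-defined single-valued map, with $z=(S+I)^{-1}x$ if and only if $x-z\in S(z)$. $P_V$ and $P_{V^\perp}$ denote the orthogonal projections onto $V$ and $V^\perp$. The (Spingarn) partial inverse of a maximal monotone operator $S$ with respect to the closed subspace $V$ is the operator $S_V:\mathcal{H}\rightrightarrows\mathcal{H}$ whose graph is $$G(S_V)=\{(z,v)\in\mathcal{H}\times\mathcal{H} : P_V(v)+P_{V^\perp}(z)\in S(P_V(z)+P_{V^\perp}(v))\};$$ it is known to be maximal monotone. SPDG algorithm: given $x_0\in V$, $y_0\in V^\perp$ and $\gamma>0$, for $k=1,2,\dots$: (1) compute $$\tilde x_k=(\gamma T+I)^{-1}(x_{k-1}+\gamma y_{k-1}),\qquad u_k=\gamma^{-1}(x_{k-1}+\gamma y_{k-1}-\tilde x_k);$$ (2) if $\tilde x_k\in V$ and $u_k\in V^\perp$, stop; otherwise set $$x_k=P_V(\tilde x_k),\qquad y_k=P_{V^\perp}(u_k),$$ and continue with $k+1$. If the algorithm stops, ''for all $k\ge1$'' refers to all $k\ge 1$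 for which the iterates involved have been generated. Proximal point method for $0\in A(z)$, $A$ maximal monotone: given $z_0\in\mathcal{H}$ and $\lambda>0$, iterate $z_k=(\lambda A+I)^{-1}z_{k-1}$ for $k\ge1$. *)

(* Defs.v *)
From HB Require Import structures.
From mathcomp Require Import all_boot all_order all_algebra.
From mathcomp Require Import all_classical all_reals all_analysis.
Set Implicit Arguments.
Unset Strict Implicit.
Unset Printing Implicit Defensive.
Import Order.TTheory GRing.Theory Num.Theory.
Import numFieldNormedType.Exports.
Local Open Scope classical_set_scope.
Local Open Scope ring_scope.

(* A real Hilbert space is given by a complete normed module [H] over
   [R : realType] and a positive definite symmetric form
   [dot : {dot H for idfun}] that induces the norm of [H]. *)

Section SetValued.
Context {R : realType} {H : completeNormedModType R}.
Implicit Types (S : H -> set H) (V : set H).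

Definition closed_subspace V : Prop :=
  GRing.submod_closed (mem V) /\ closed V.

Definition graph S : set (H * H) := [set p | S p.1 p.2].

Definition scale_op (g : R) S : H -> set H :=
  fun z => [set g *: v | v in S z].

(* (S + I)^-1 as a set-valued map; when it is single-valued at x, the equation
   z = (S + I)^-1 x reads [resolvent S x = [set z]]. *)
Definition resolvent S : H -> set H :=
  fun x => [set z | [set v + z | v in S z] x].

End SetValued.

Section Hilbert.
Context {R : realType} {H : completeNormedModType R}.
Variable dot : {dot H for (@idfun R)}.
Implicit Types (S A T : H -> set H) (V : set H) (x y xt u : nat -> H).

Definition monotone_op S : Prop :=
  forall z z' v v', S z v -> S z' v' -> 0 <= dot (z - z') (v - v').

Definition maximal_monotone S : Prop :=
  monotone_op S /\
  forall S', monotone_op S' -> ~ (graph S `<` graph S').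

Definition orthogonal_compl V : set H :=
  [set w | forall v, V v -> dot w v = 0].

(* The value 0 is a default, used only if no point satisfies the condition;
   this never happens for a closed subspace of a Hilbert space. *)
Definition orth_proj V (z : H) : H :=
  xget 0 [set p | V p /\ orthogonal_compl V (z - p)].

Definition partial_inverse S V : H -> set H :=
  fun z => [set v |
    S (orth_proj V z + orth_proj (orthogonal_compl V) v)
      (orth_proj V v + orth_proj (orthogonal_compl V) z)].

Definition spdg_stop V xt u (k : nat) : Prop :=
  V (xt k) /\ orthogonal_compl V (u k).

(* The stopping test failed at steps 1, ..., k; that is, x_k and y_k have been
   generated. *)
Definition spdg_runs V xt u (k : nat) : Prop :=
  forall j, (0 < j <= k)%N -> ~ spdg_stop V xt u j.

(* The sequences are total functions, but nothing is required of them past the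
   last generated iterate. Both xt 0 and u 0 are meaningless. *)
Record spdg T V (gamma : R) (x0 y0 : H) x y xt u : Prop := Spdg {
  spdg_x0 : x 0%N = x0;
  spdg_y0 : y 0%N = y0;
  spdg_xt : forall k, (0 < k)%N -> spdg_runs V xt u k.-1 ->
    resolvent (scale_op gamma T) (x k.-1 + gamma *: y k.-1) = [set xt k];
  spdg_u : forall k, (0 < k)%N -> spdg_runs V xt u k.-1 ->
    u k = gamma^-1 *: (x k.-1 + gamma *: y k.-1 - xt k);
  spdg_x : forall k, (0 < k)%N -> spdg_runs V xt u k ->
    x k = orth_proj V (xt k);
  spdg_y : forall k, (0 < k)%N -> spdg_runs V xt u k ->
    y k = orth_proj (orthogonal_compl V) (u k)
}.

(* z 0, ..., z n are the first iterates of the proximal point method for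
   0 \in A z. *)
Record proximal_point A (lambda : R) (z0 : H) (n : nat) (z : nat -> H) : Prop :=
  ProximalPoint {
    pp_maximal_monotone : maximal_monotone A;
    pp_lambda_gt0 : 0 < lambda;
    pp_z0 : z 0%N = z0;
    pp_step : forall k, (0 < k <= n)%N ->
      resolvent (scale_op lambda A) (z k.-1) = [set z k]
  }.

End Hilbert.

(* Main.v *)
(* With P, Q the projections onto V and its orthogonal complement, the map
   (z, v) |-> (P z + Q v, P v + Q z) is a linear involution of H * H which
   preserves the form <z, v>, and the graph of the partial inverse is the image
   of the graph of the operator under it. Hence partial inversion preserves
   maximal monotonicity. One step of SPDG computes the point p with
   w - p \in gamma T p, where w = z_(k-1); the involution sends the pair
   (p, w - p) to (z_k, w - z_k), so that w - z_k lies in the partial inverse at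
   z_k. Uniqueness of the resolvent value follows from monotonicity. *)
Require Import Defs.
From HB Require Import structures.
From mathcomp Require Import all_boot all_order all_algebra.
From mathcomp Require Import all_classical all_reals all_analysis.
From mathcomp Require Import ring lra.
Import Order.TTheory GRing.Theory Num.Theory.
Import numFieldNormedType.Exports.
Local Open Scope classical_set_scope.
Local Open Scope ring_scope.

(** * Real inner products, monotone operators and resolvents *)

Section RealDot.
Context {R : realType} {H : completeNormedModType R}.
Variable dot : {dot H for (@idfun R)}.
Implicit Types (u v w z p : H) (a : R) (V : set H) (S : H -> set H).

Lemma dotC u v : dot u v = dot v u.
Proof. by rewrite hermC expr0 mul1r. Qed.

Lemma dotZl a u v : dot (a *: u) v = a * dot u v.
Proof. by rewrite linearZl_LR. Qed.

Lemma dotZr a u v : dot u (a *: v) = a * dot u v.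
Proof. by rewrite linearZr_LR. Qed.

Lemma dot_gt0 u : u != 0 -> 0 < dot u u.
Proof. exact: neq0_dnorm_gt0. Qed.

Lemma dot_eq0 u : dot u u <= 0 -> u = 0.
Proof. by apply: contraPeq => /dot_gt0; rewrite ltNge => /negP. Qed.

Lemma dot_parallelogram u v :
  dot (u - v) (u - v) =
  2 * dot u u + 2 * dot v v - 4 * dot (2^-1 *: (u + v)) (2^-1 *: (u + v)).
Proof.
rewrite dotZl dotZr !(linearDl, linearNl) !(linearDr, linearNr).
by rewrite /= (dotC v u); field.
Qed.

(** If [q] is the chosen point, [q - p] is a difference of two vectors orthogonal to [p] and [q],
    hence orthogonal to itself. [V] is an arbitrary set, so that this also applies to the
    complement. *)
Lemma orth_proj_eq V z p :
  V p -> orthogonal_compl dot V (z - p) -> orth_proj dot V z = p.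
Proof.
move=> Vp Np; rewrite /orth_proj.
have [|] := @xgetPex _ 0 [set q | V q /\ orthogonal_compl dot V (z - q)].
  by exists p.
set q := xget _ _ => Vq Nq.
apply/eqP; rewrite -subr_eq0; apply/eqP/dot_eq0.
have E : q - p = (z - p) - (z - q) by rewrite opprB [RHS]addrC subrKA.
by rewrite {1}E linearBl !linearBr /= !Np// !Nq// !subrr.
Qed.

(** Turns strict inclusion of graphs into the pointwise form of maximality used below; the next
    lemma is the converse. *)
Lemma maximal_monotone_sub S S' : maximal_monotone dot S ->
  monotone_op dot S' -> (forall z v, S z v -> S' z v) ->
  forall z v, S' z v -> S z v.
Proof.
move=> [_ Smax] S'mono SS' z v S'zv; apply: contrapT => NS.
apply: (Smax _ S'mono); split=> [[? ?]|]; first exact: SS'.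
by move=> /(_ (z, v) S'zv).
Qed.

Lemma maximal_monotoneI S : monotone_op dot S ->
  (forall S', monotone_op dot S' -> (forall z v, S z v -> S' z v) ->
   forall z v, S' z v -> S z v) ->
  maximal_monotone dot S.
Proof.
move=> Smono Smax; split=> // S' S'mono [SS' []] [z v].
by apply: Smax => // ? ? /(SS' (_, _)).
Qed.

Lemma scale_op_maximal_monotone a S : 0 < a ->
  maximal_monotone dot S -> maximal_monotone dot (scale_op a S).
Proof.
move=> a0 /[dup] Smax [Smono _]; apply: maximal_monotoneI.
  move=> z z' _ _ [v Sv <-] [v' Sv' <-].
  by rewrite -scalerBr dotZr pmulr_rge0//; exact: Smono.
(* Scaling a monotone extension of [scale_op a S] by [a^-1] gives a monotone extension of [S]. *)
move=> S' S'mono SS' z v S'v; exists (a^-1 *: v).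
  apply: (@maximal_monotone_sub S (scale_op a^-1 S')) => //.
  - move=> w w' _ _ [q Sq <-] [q' Sq' <-].
    by rewrite -scalerBr dotZr pmulr_rge0 ?invr_gt0//; exact: S'mono.
  - move=> w q Sq; exists (a *: q); first by apply: SS'; exists q.
    by rewrite scalerA mulVf ?gt_eqF// scale1r.
  - by exists v.
by rewrite scalerA divff ?gt_eqF// scale1r.
Qed.

Lemma monotone_resolvent S w z : monotone_op dot S ->
  S z (w - z) -> resolvent S w = [set z].
Proof.
move=> Smono Sz; apply/seteqP; split=> [z' [v Sv vz']|_ ->]; last first.
  by exists (w - z) => //; rewrite subrK.
(* Two resolvent values differ by the opposite of the difference of their images, so monotonicity
   makes minus a squared norm nonnegative. *)
apply/eqP; rewrite -subr_eq0; apply/eqP/dot_eq0; rewrite -oppr_ge0 -linearNr.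
have -> : - (z' - z) = v - (w - z).
  by rewrite -vz' !opprB [RHS]addrCA opprD addNKr.
exact: Smono.
Qed.

Lemma scale_op1 S : scale_op 1 S = S.
Proof.
apply/funext => z; apply/seteqP; split=> [_ [v Sv <-]|v Sv].
  by rewrite scale1r.
by exists v; rewrite ?scale1r.
Qed.

(** * Orthogonal projection onto a closed subspace *)

Section Projection.
Hypothesis norm_dot : forall w, `|w| ^+ 2 = dot w w.
Variable V : set H.
Hypothesis V_sub : closed_subspace V.

Lemma subspace_lin a u v : V u -> V v -> V (a *: u + v).
Proof. by case: V_sub => -[_ Vlin] _; have := Vlin a u v; rewrite !inE. Qed.

Lemma subspace0 : V 0.
Proof. by case: V_sub => -[+ _] _; rewrite inE. Qed.

(** A minimising sequence in [V] is Cauchy by the parallelogram law; its limit exists by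
    completeness and lies in [V] by closedness. *)
Lemma closest_point_exists z :
  exists2 p, V p & forall v, V v -> dot (z - p) (z - p) <= dot (z - v) (z - v).
Proof.
pose D := [set dot (z - v) (z - v) | v in V]; pose d := inf D.
have D_lb : has_lbound D.
  by exists 0 => _ [v _ <-]; rewrite -norm_dot exprn_ge0.
have d_le v : V v -> d <= dot (z - v) (z - v).
  by move=> Vv; apply: ge_inf => //; exists v.
have D_inf : has_inf D.
  by split=> //; exists (dot (z - 0) (z - 0)), 0 => //; exact: subspace0.
have [n|s s_min] := @choice nat H
    (fun n v => V v /\ dot (z - v) (z - v) < d + n.+1%:R^-1).
  have n0 : (0 : R) < n.+1%:R^-1 by rewrite invr_gt0.
  by have [_ [v Vv <-] vd] := inf_adherent n0 D_inf; exists v.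
have near_small (e : R) : 0 < e -> \forall n \near \oo, n.+1%:R^-1 < e :> R.
  by move=> e0; exact: (near_infty_natSinv_lt (PosNum e0)).
have s_cauchy : cauchy (s @ \oo).
  apply: cauchy_exP => e e0.
  (* The squared gap will be at most [2 / n.+1 + 2 / m.+1], which this threshold keeps below
     [e ^+ 2]. *)
  have e40 : 0 < e ^+ 2 / 4 by rewrite divr_gt0 ?exprn_gt0.
  have [n _ n_small] := near_small _ e40.
  exists (s n); exists n => // m /= nm; rewrite -ball_normE /=.
  rewrite -(@ltr_pXn2r _ 2) ?nnegrE ?normr_ge0 ?(ltW e0)// norm_dot.
  have [[Vn n_min] [Vm m_min]] := (s_min n, s_min m).
  have Vnm : V (2^-1 *: (s n + s m)).
    by rewrite scalerDr; apply: subspace_lin => //;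
       rewrite -[_ *: _]addr0; apply: subspace_lin => //; exact: subspace0.
  (* The midpoint of s n and s m lies in V, so it is at squared distance at
     least d from z; the parallelogram law then bounds the gap. *)
  have := dot_parallelogram (z - s m) (z - s n).
  have -> : z - s m - (z - s n) = s n - s m.
    by rewrite opprB [LHS]addrC subrKA.
  have -> : 2^-1 *: (z - s m + (z - s n)) = z - 2^-1 *: (s n + s m).
    rewrite addrACA -opprD scalerBr -mulr2n -[z *+ 2]scaler_nat scalerA mulVf//.
    by rewrite scale1r [s m + _]addrC.
  have := d_le _ Vnm.
  have : n.+1%:R^-1 < e ^+ 2 / 4 := n_small _ (leqnn n).
  have : m.+1%:R^-1 < e ^+ 2 / 4 := n_small _ nm.
  by move: n_min m_min; move: (n.+1%:R^-1) (m.+1%:R^-1) => *; lra.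
have /cvg_ex [p s_p] : cvg (s @ \oo) by exact/cauchy_cvgP.
exists p.
  case: V_sub => _ V_closed; apply: closed_cvg s_p => //.
  by apply: nearW => n; case: (s_min n).
move=> v Vv; apply: le_trans (d_le v Vv); apply/ler_addgt0Pr => e e0.
(* Convergence comes from continuity of the norm, through [norm_dot]. *)
have cvg_dot : dot (z - s n) (z - s n) @[n --> \oo] --> dot (z - p) (z - p).
  rewrite -norm_dot expr2.
  under eq_fun do rewrite -norm_dot expr2.
  by apply: cvgM; apply: cvg_norm; apply: cvgB => //; exact: cvg_cst.
apply: (cvgr_to_le cvg_dot); near=> n.
apply/ltW/(lt_trans (s_min n).2); rewrite ltrD2l; near: n; exact: near_small.
Unshelve. all: by end_near. Qed.

Lemma orth_projP z :
  V (orth_proj dot V z) /\ orthogonal_compl dot V (z - orth_proj dot V z).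
Proof.
have [p Vp p_min] := closest_point_exists z.
suff Np : orthogonal_compl dot V (z - p) by rewrite (orth_proj_eq _ _ _ Vp Np).
move=> v Vv; have [->|/dot_gt0 v0] := eqVneq v 0; first by rewrite linear0r.
set c := dot (z - p) v.
(* This coefficient minimises the distance from [z] along the line through [p] directed by [v];
   minimality of [p] then forces [c ^+ 2 / dot v v <= 0]. *)
have := p_min _ (subspace_lin (c / dot v v) _ _ Vv Vp).
have -> : z - (c / dot v v *: v + p) = z - p - c / dot v v *: v.
  by rewrite opprD addrA addrAC.
move: (z - p) @c => w c.
rewrite [leRHS]linearBl/= !linearBr/= !(dotZl, dotZr) (dotC v) -/c.
have -> : c / dot v v * (c / dot v v * dot v v) = c / dot v v * c.
  by rewrite divfK ?gt_eqF.
rewrite subrr subr0 lerDl oppr_ge0 mulrAC -expr2 pmulr_lle0 ?invr_gt0// => c2.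
by apply/eqP; rewrite -sqrf_eq0 eq_le c2 sqr_ge0.
Qed.

Local Notation N := (orthogonal_compl dot V).
Local Notation P := (orth_proj dot V).
Local Notation Q := (orth_proj dot N).

(** The residual [z - P z] lies in [N], and what it leaves, [P z], lies in [V] and so is orthogonal
    to [N]. *)
Lemma orth_proj_complE z : Q z = z - P z.
Proof.
have [VP NP] := orth_projP z.
by apply: orth_proj_eq => //; rewrite subKr => w Nw; rewrite dotC Nw.
Qed.

Lemma orth_projDE z : P z + Q z = z.
Proof. by rewrite orth_proj_complE addrC subrK. Qed.

Lemma orth_proj_in z : V (P z).
Proof. exact: (orth_projP z).1. Qed.

Lemma orth_proj_compl_in z : N (Q z).
Proof. by rewrite orth_proj_complE; exact: (orth_projP z).2. Qed.

Lemma orth_proj_add p w : V p -> N w -> P (p + w) = p.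
Proof. by move=> Vp Nw; apply: orth_proj_eq => //; rewrite addrC addKr. Qed.

Lemma orth_proj_compl_add p w : V p -> N w -> Q (p + w) = w.
Proof.
by move=> Vp Nw; rewrite orth_proj_complE orth_proj_add// addrC addKr.
Qed.

Lemma orth_proj_linear a u v : P (a *: u + v) = a *: P u + P v.
Proof.
apply: orth_proj_eq; first by apply: subspace_lin; exact: orth_proj_in.
rewrite opprD addrACA -scalerBr -!orth_proj_complE => w Vw.
by rewrite linearDl/= dotZl !orth_proj_compl_in// mulr0 addr0.
Qed.

Lemma orth_projB u v : P (u - v) = P u - P v.
Proof. by rewrite addrC -scaleN1r orth_proj_linear scaleN1r addrC. Qed.

Lemma orth_proj_complB u v : Q (u - v) = Q u - Q v.
Proof. by rewrite !orth_proj_complE orth_projB !opprD addrACA. Qed.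

Lemma orth_proj_complZ a u : Q (a *: u) = a *: Q u.
Proof.
have P0 : P 0 = 0 by rewrite -[in LHS](subrr 0) orth_projB subrr.
by rewrite !orth_proj_complE -[a *: u]addr0 orth_proj_linear P0 !addr0 scalerBr.
Qed.

(** * Partial inverses and their resolvents *)

Lemma dot_orth_swap u v : dot (P u + Q v) (P v + Q u) = dot u v.
Proof.
rewrite -[in RHS](orth_projDE u) -[in RHS](orth_projDE v).
have PQ w w' : dot (P w) (Q w') = 0.
  by rewrite dotC; apply: orth_proj_compl_in; exact: orth_proj_in.
have QP w w' : dot (Q w) (P w') = 0 by rewrite dotC.
rewrite !linearDl/= !linearDr/= !(PQ, QP) !addr0 !add0r.
by rewrite [dot (Q v) _]dotC.
Qed.

Lemma partial_inverse_monotone S :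
  monotone_op dot S -> monotone_op dot (partial_inverse dot S V).
Proof.
move=> Smono z z' v v' Sv Sv'; rewrite -dot_orth_swap.
rewrite !orth_projB !orth_proj_complB ![P _ - _ + _]addrACA -!opprD.
exact: Smono.
Qed.

Lemma partial_inverseK S : partial_inverse dot (partial_inverse dot S V) V = S.
Proof.
apply/funext => z; apply/funext => v; rewrite /partial_inverse /=.
have [Vp Nq] := (orth_proj_in, orth_proj_compl_in).
by rewrite !orth_proj_add// !orth_proj_compl_add// !orth_projDE.
Qed.

Lemma partial_inverse_maximal_monotone S : maximal_monotone dot S ->
  maximal_monotone dot (partial_inverse dot S V).
Proof.
move=> Smax; apply: maximal_monotoneI.
  by apply: partial_inverse_monotone; case: Smax.
move=> S' S'mono SS' z v; rewrite -[in S' z v](partial_inverseK S').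
apply: (maximal_monotone_sub S (partial_inverse dot S' V)) => //.
  exact: partial_inverse_monotone.
by move=> w q; rewrite -[in S w q](partial_inverseK S); exact: SS'.
Qed.

(** With [w] = [z k.-1], [p] = [xt k] and [w - p] = [gamma *: u k], this is the first identity of
    the theorem. *)
Lemma sub_orth_swap w p : w - (P p + Q (w - p)) = P (w - p) + Q p.
Proof.
rewrite orth_projB orth_proj_complB -{1}(orth_projDE w).
by rewrite [_ + (Q w - _)]addrCA addrKA opprB addrA addrAC.
Qed.

Lemma partial_inverse_resolvent S w p : monotone_op dot S -> S p (w - p) ->
  resolvent (partial_inverse dot S V) w = [set P p + Q (w - p)].
Proof.
move=> Smono Sp; apply: monotone_resolvent.
  exact: partial_inverse_monotone.
rewrite sub_orth_swap /partial_inverse /=; move: (w - p) Sp => v Sp.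
have [Vp Nq] := (orth_proj_in, orth_proj_compl_in).
by rewrite !orth_proj_add// !orth_proj_compl_add// !orth_projDE.
Qed.

End Projection.
End RealDot.

Theorem proposition2p3 (R : realType) (H : completeNormedModType R)
  (dot : {dot H for (@idfun R)})
  (norm_dot : forall w : H, `|w| ^+ 2 = dot w w)
  (V : set H) (V_sub : closed_subspace V)
  (T : H -> set H) (T_max : maximal_monotone dot T)
  (eta L : R) (eta_gt0 : 0 < eta) (L_gt0 : 0 < L)
  (T_strong : forall z z' v v', T z v -> T z' v' ->
     eta * `|z - z'| ^+ 2 <= dot (z - z') (v - v'))
  (T_lip : forall z z' v v', T z v -> T z' v' -> `|v - v'| <= L * `|z - z'|)
  (x0 y0 : H) (x0_V : V x0) (y0_V : orthogonal_compl dot V y0)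
  (gamma : R) (gamma_gt0 : 0 < gamma)
  (x y xt u : nat -> H) (run : spdg dot T V gamma x0 y0 x y xt u)
  (z : nat -> H) (z_def : forall k, z k = x k + gamma *: y k) :
  (forall k, (1 <= k)%N -> spdg_runs dot V xt u k ->
     z k.-1 - z k = orth_proj dot V (gamma *: u k)
                    + orth_proj dot (orthogonal_compl dot V) (xt k)
     /\ resolvent (partial_inverse dot (scale_op gamma T) V) (z k.-1)
        = [set z k])
  /\ (forall n, spdg_runs dot V xt u n ->
       proximal_point dot (partial_inverse dot (scale_op gamma T) V) 1
         (x0 + gamma *: y0) n z).
Proof.
have gT_max := scale_op_maximal_monotone dot gamma T gamma_gt0 T_max.
have runsW k n : (k <= n)%N -> spdg_runs dot V xt u n -> spdg_runs dot V xt u k.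
  by move=> kn runs j /andP[j0 jk]; apply: runs; rewrite j0 (leq_trans jk).
have step k : (1 <= k)%N -> spdg_runs dot V xt u k ->
    z k.-1 - z k = orth_proj dot V (gamma *: u k)
                   + orth_proj dot (orthogonal_compl dot V) (xt k)
    /\ resolvent (partial_inverse dot (scale_op gamma T) V) (z k.-1)
       = [set z k].
  (* The equations for [xt k] and [u k] assume that the test failed before step [k], those for [x k]
     and [y k] that it failed at step [k] too. *)
  move=> k0 runs; have runs' := runsW _ _ (leq_pred k) runs.
  have gu : gamma *: u k = z k.-1 - xt k.
    by rewrite (spdg_u run k0 runs') z_def scalerA divff ?gt_eqF// scale1r.
  have zk : z k = orth_proj dot V (xt k)
                  + orth_proj dot (orthogonal_compl dot V) (z k.-1 - xt k).
    rewrite z_def (spdg_x run k0 runs) (spdg_y run k0 runs) -gu.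
    by rewrite orth_proj_complZ.
  (* Unfolding the resolvent gives the pair in the graph of [gamma T] that the involution is applied
     to. *)
  have gT_xt : scale_op gamma T (xt k) (z k.-1 - xt k).
    have : resolvent (scale_op gamma T) (z k.-1) (xt k).
      by rewrite z_def (spdg_xt run k0 runs').
    by move=> [v gTv <-]; rewrite addrK.
  rewrite gu zk; split; first exact: sub_orth_swap.
  by apply: partial_inverse_resolvent => //; case: gT_max.
split=> // n runs; split=> //.
- exact: partial_inverse_maximal_monotone.
- by rewrite z_def (spdg_x0 run) (spdg_y0 run).
- move=> k /andP[k0 kn]; rewrite scale_op1.
  by apply: (step k k0 _).2; exact: runsW runs.
Qed.
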